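(* Let $X,Y$ be Banach spaces and let $u:\mathbb{R}_{\ge 0}\to\mathcal{L}(X;Y)$ be a function. Then the following are equivalent: (a) for each $x\in X$ there is $t_x\ge 0$ such that the orbit $u_x$ is bounded on $(t_x,\infty)$; (b) there is $t\ge 0$ such that for all $x\in X$ the orbit $u_x$ is bounded on $(t,\infty)$.
   Context: $X,Y$ are Banach spaces over the same field $\mathbb{R}$ or $\mathbb{C}$; $\mathcal{L}(X;Y)$ is the space of bounded linear operators from $X$ to $Y$; $\mathbb{R}_{\ge 0}=[0,\infty)$. No continuity or other regularity of $u$ is assumed. For $x\in X$, the orbit is the function $u_x:\mathbb{R}_{\ge 0}\to Y$, $u_x(t)=u(t)x$. *)

(* Defs.v *)
From mathcomp Require Import all_boot all_order all_algebra.
From mathcomp Require Import all_classical all_reals all_analysis.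
From mathcomp Require Import complex.
Import Order.TTheory GRing.Theory Num.Theory.
Import numFieldNormedType.Exports.

Set Implicit Arguments.
Unset Strict Implicit.
Unset Printing Implicit Defensive.

Local Open Scope classical_set_scope.
Local Open Scope ring_scope.

(* The bound C lives in K because norms are K-valued in MathComp-Analysis;
   for K = R[i] the order makes C a nonnegative real as soon as X != 0. *)
Record bounded_linear_operator (K : numFieldType) (X Y : normedModType K) :=
  BoundedLinearOperator {
    blo_fun :> {linear X -> Y};
    blo_bounded : exists C : K, forall x : X, `|blo_fun x| <= C * `|x|
  }.

Definition operator_orbit (R : realType) (K : numFieldType)
    (X Y : normedModType K) (u : {nonneg R} -> bounded_linear_operator X Y)
    (x : X) : {nonneg R} -> Y :=
  fun t => u t x.

(* Main.v *)
Require Import Defs.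
From mathcomp Require Import all_boot all_order all_algebra.
From mathcomp Require Import all_classical all_reals all_analysis.
From mathcomp Require Import complex.
Import Order.TTheory GRing.Theory Num.Theory.
Import numFieldNormedType.Exports.
Local Open Scope classical_set_scope.
Local Open Scope ring_scope.

Set Implicit Arguments.
Unset Strict Implicit.
Unset Printing Implicit Defensive.

(** The implication from a common threshold to pointwise thresholds is
    immediate.  For the converse, replace the real thresholds by natural ones
    and suppose that for every [n] some vector [y_n] has an orbit unbounded
    beyond [n].  A gliding hump then produces a single vector whose orbit is
    unbounded beyond every threshold.

    Given a closed ball with centre [x], at least one of [x] and
    [x + e *: y_n] has an orbit unbounded beyond [n], because [e *: y_n] is
    the difference of the two; taking [e] small keeps this vector inside the
    ball.  Some operator with index beyond [n] thus has a large value there,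
    and, being bounded, still has a large value on a whole smaller ball
    ([hump_step]).  Iterating gives nested balls with radii tending to [0],
    and by completeness of [X] their centres converge to the desired vector
    ([nested_balls_cvg], [eventually_bounded_uniform]).

    The argument is run over any [numFieldType] in which every nonnegative
    element lies below a natural number.  This covers the real and the complex
    field at once: norms take values in the scalar field, are nonnegative, and
    so are comparable with each other and with natural numbers. *)

(** * Bounded families and archimedean scalars *)

Lemma bounded_on_exP (I : Type) (K : numFieldType) (V : normedModType K)
    (f : I -> V) (A : set I) :
  [bounded f i | i in A] <->
  exists2 M : K, 0 <= M & forall i, A i -> `|f i| <= M.
Proof.
split=> [/ex_strict_bound_gt0[M M0 fM]|[M M0 fM]].
  by exists M; [exact: ltW | move=> i Ai; exact: ltW (fM i Ai)].
exists M; split; first exact: ger0_real.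
by move=> N MN i Ai; exact: le_trans (fM i Ai) (ltW MN).
Qed.

Lemma unbounded_onP (I : Type) (K : numFieldType) (V : normedModType K)
    (f : I -> V) (A : set I) :
  ~ [bounded f i | i in A] ->
  forall M : K, 0 <= M -> exists2 i, A i & M < `|f i|.
Proof.
move=> nb M M0; apply: contrapT => H; apply: nb; apply/bounded_on_exP.
exists M => // i Ai.
rewrite real_leNgt ?ger0_real//; apply/negP => Mf; apply: H; by exists i.
Qed.

(** A nonnegative complex number is real, so the archimedean property of [R]
    transfers to the part of [R[i]] in which norms live. *)
Lemma real_or_complex_archi (R : realType) (K : numFieldType) :
  K = (R : numFieldType) \/ K = (R[i] : numFieldType) ->
  forall a : K, 0 <= a -> exists n : nat, a <= n%:R.
Proof.
case=> ->.
  by move=> a _; exists (Num.truncn a).+1; rewrite ltW// truncnS_gt.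
move=> [a b]; rewrite lecE/= => /andP[/eqP -> _].
exists (Num.truncn a).+1.
rewrite -(rmorph_nat (real_complex R)) lecE/= eqxx/=.
by rewrite ltW// truncnS_gt.
Qed.

(** * Nested balls *)

(** The centres form a Cauchy sequence, and [x] is their limit.  The strict
    bound [2 * r n], weaker than [r n], comes from comparing [x] with one late
    centre by the triangle inequality, and thus needs no passage to the limit
    in the partially ordered scalar field. *)
Lemma nested_balls_cvg (K : numFieldType) (X : completeNormedModType K)
    (archi : forall a : K, 0 <= a -> exists n : nat, a <= n%:R)
    (c : nat -> X) (r : nat -> K) :
  (forall n, 0 < r n) ->
  (forall n, r n.+1 <= n.+1%:R^-1) ->
  (forall n, `|c n.+1 - c n| + r n.+1 <= r n) ->
  exists x : X, forall n, `|x - c n| < 2 * r n.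
Proof.
move=> r0 rsmall nest.
have nested n k : `|c (k + n)%N - c n| + r (k + n)%N <= r n.
  elim: k => [|k IH]; first by rewrite add0n subrr normr0 add0r.
  apply: le_trans IH; rewrite addSn.
  rewrite -[c _.+1](subrK (c (k + n)%N)) -addrA.
  apply: le_trans (lerD (ler_normD _ _) (lexx _)) _.
  by rewrite addrAC addrC lerD2l.
have close n m : (n <= m)%N -> `|c m - c n| < r n.
  move=> nm; rewrite -(subnK nm).
  by apply: lt_le_trans (nested n (m - n)%N); rewrite ltrDl.
have /cauchy_cvg/cvg_ex[x cx] : cauchy (c @ \oo).
  apply: cauchy_exP => e e0.
  have [n ne] := archi e^-1 (ltW (eqbRL (invr_gt0 _) e0)).
  exists (c n.+1); exists n.+1 => // m /= nm.
  rewrite -ball_normE /ball_/= distrC.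
  apply: lt_le_trans (close _ _ nm) _.
  apply: le_trans (rsmall n) _.
  rewrite -[leRHS]invrK lef_pV2 ?posrE ?invr_gt0//.
  by apply: le_trans ne _; rewrite ler_nat.
exists x => n.
have [N _ xN] := (cvgrPdist_lt _ _).1 cx _ (r0 n).
have {}xN : `|x - c (maxn N n)| < r n := xN (maxn N n) (leq_maxl _ _).
rewrite -(subrK (c (maxn N n)) x) -addrA.
apply: le_lt_trans (ler_normD _ _) _.
by rewrite mulr_natl mulr2n ltrD// close// leq_maxr.
Qed.

(** * The gliding hump *)

Lemma bounded_linear_pos_bound (K : numFieldType) (X Y : normedModType K)
    (T : bounded_linear_operator X Y) :
  exists2 C : K, 0 < C & forall x, `|T x| <= C * `|x|.
Proof.
have [C TC] := blo_bounded T; exists (`|C| + 1); first by rewrite ltr_wpDl.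
move=> x; apply: (@le_trans _ _ (`|C| * `|x|)).
  (* [C * `|x|] dominates a norm, so it is nonnegative even if [C] is not. *)
  rewrite -[X in _ * X]normr_id -normrM ger0_norm ?TC//.
  exact: le_trans (TC x).
by rewrite ler_wpM2r// lerDl.
Qed.

(** One hump.  The conclusion is stated on the ball of radius [2 * r'] because
    the limit of the nested balls is only located up to this factor. *)
Lemma hump_step (I : Type) (K : numFieldType) (X Y : normedModType K)
    (T : I -> bounded_linear_operator X Y) (A : set I) (y : X)
    (M : K) (N : nat) (c : X) (r : K) :
  ~ [bounded T i y | i in A] -> 0 <= M -> 0 < r ->
  exists (c' : X) (r' : K), [/\ 0 < r', r' <= N.+1%:R^-1,
    `|c' - c| + r' <= r &
    exists2 i, A i & forall w, `|w - c'| < 2 * r' -> M < `|T i w|].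
Proof.
move=> unby M0 r0.
pose e : K := r / 2 / (`|y| + 1).
have y1 : 0 < `|y| + 1 by rewrite ltr_wpDl.
have e0 : 0 < e by rewrite !divr_gt0.
have [z zc unbz] : exists2 z, `|z - c| <= r / 2 & ~ [bounded T i z | i in A].
  have [bc|] := pselect [bounded T i c | i in A]; last first.
    by exists c => //; rewrite subrr normr0 divr_ge0// ltW.
  exists (c + e *: y).
    rewrite addrC addKr normrZ gtr0_norm// /e mulrAC ler_pdivrMr//.
    by rewrite ler_pM2l ?divr_gt0// lerDl.
  move=> /bounded_on_exP[M1 M10 bM1]; apply: unby.
  move: bc => /bounded_on_exP[M2 M20 bM2]; apply/bounded_on_exP.
  exists (e^-1 * (M1 + M2)) => [|i Ai].
    by rewrite mulr_ge0 ?addr_ge0// invr_ge0 ltW.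
  rewrite ler_pdivlMl// -{1}(gtr0_norm e0) -normrZ -linearZ.
  rewrite -[e *: y](addKr c) addrC linearB.
  apply: le_trans (ler_normB _ _) _.
  by rewrite lerD ?bM1 ?bM2.
have [i Ai Mi] := unbounded_onP unbz (addr_ge0 M0 ler01).
have [C C0 TC] := bounded_linear_pos_bound (T i).
(* The inverse of a sum of positive terms lies below the inverse of each: this
   replaces a minimum, which a partial order need not provide. *)
pose r' : K := (N.+1%:R + (2 / r + 2 * C))^-1.
have rC0 : 0 < 2 / r + 2 * C by rewrite addr_gt0 ?divr_gt0 ?mulr_gt0.
have s0 : 0 < N.+1%:R + (2 / r + 2 * C) by rewrite addr_gt0.
have r'0 : 0 < r' by rewrite invr_gt0.
have r'r : r' <= r / 2.
  rewrite -[r / 2]invrK lef_pV2 ?posrE ?invr_gt0 ?divr_gt0//.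
  rewrite invf_div addrCA lerDl.
  by rewrite addr_ge0// mulr_ge0// ltW.
have r'C : C * (2 * r') <= 1.
  rewrite mulrA [C * 2]mulrC ler_pdivrMr// mul1r addrA lerDr.
  by rewrite addr_ge0// divr_ge0// ltW.
exists z, r'; split=> //.
- by rewrite lef_pV2 ?posrE// lerDl ltW.
- by rewrite [leRHS]splitr lerD.
exists i => // w wz.
rewrite -(ltrD2r 1); apply: lt_le_trans Mi _.
rewrite -[z](subKr w) linearB.
apply: le_trans (ler_normB _ _) _; rewrite lerD2l.
apply: le_trans (TC _) _; apply: le_trans r'C.
by rewrite ler_pM2l// ltW.
Qed.

(** If no [A n] serves all vectors, iterating [hump_step] gives a vector [x]
    and indices [i_n] in [A n] with [n < `|T i_n x|].  As the sets [A n]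
    decrease, the [i_n] with [n] large lie in any given [A m], so that the
    orbit of [x] is bounded over no [A m].  Thresholds in time are
    the case [A n = (n, +oo)]. *)
Lemma eventually_bounded_uniform (I : Type) (K : numFieldType)
    (archi : forall a : K, 0 <= a -> exists n : nat, a <= n%:R)
    (X : completeNormedModType K) (Y : normedModType K)
    (T : I -> bounded_linear_operator X Y) (A : nat -> set I) :
  (forall n m, (n <= m)%N -> A m `<=` A n) ->
  (forall x, exists n, [bounded T i x | i in A n]) ->
  exists n, forall x, [bounded T i x | i in A n].
Proof.
move=> decA bT; apply: contrapT => /forallNP nb.
have {nb}/choice[y unby] n : exists x, ~ [bounded T i x | i in A n].
  exact/existsNP/(nb n).
(* A ball is a pair of a centre and a positive radius. *)
pose P (nb : nat * (X * {posnum K})) (b' : X * {posnum K}) :=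
  [/\ b'.2%:num <= nb.1.+1%:R^-1, `|b'.1 - nb.2.1| + b'.2%:num <= nb.2.2%:num &
    exists2 i, A nb.1 i &
      forall w, `|w - b'.1| < 2 * b'.2%:num -> nb.1%:R < `|T i w|].
have /choice[f Pf] : forall nb, exists b', P nb b'.
  move=> [n [c r]].
  have [c' [r' [r'0 r'n r'r H]]] :=
    hump_step n c (unby n) (ler0n _ n) (gt0 r).
  by exists (c', PosNum r'0).
pose fix b n := if n is m.+1 then f (m, b m) else (0, PosNum ltr01).
have Pb n : P (n, b n) (b n.+1) := Pf (n, b n).
have [||| x xb] := @nested_balls_cvg K X archi
    (fun n => (b n).1) (fun n => (b n).2%:num).
- by [].
- by move=> n; have [] := Pb n.
- by move=> n; have [] := Pb n.
have [m /bounded_on_exP[M M0 bM]] := bT x.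
have [k Mk] := archi M M0.
have [_ _ [i Ai]] := Pb (maxn m k).
move=> /(_ x (xb _)) /=; apply/negP; rewrite -real_leNgt//.
apply: le_trans (bM i (decA _ _ (leq_maxl m k) i Ai)) _.
by apply: le_trans Mk _; rewrite ler_nat leq_maxr.
Qed.

(** * Thresholds for orbits *)

Theorem proposition3p2 (R : realType) (K : numFieldType)
    (hK : K = (R : numFieldType) \/ K = (R[i] : numFieldType))
    (X Y : completeNormedModType K)
    (u : {nonneg R} -> bounded_linear_operator X Y) :
  (forall x : X, exists t : {nonneg R},
     [bounded operator_orbit u x s | s in [set s : {nonneg R} | t%:num < s%:num]])
  <->
  (exists t : {nonneg R}, forall x : X,
     [bounded operator_orbit u x s | s in [set s : {nonneg R} | t%:num < s%:num]]).
Proof.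
split=> [bu|[t bu] x]; last by exists t.
have [| |n bn] := @eventually_bounded_uniform _ K (real_or_complex_archi hK)
    X Y u (fun n => [set s : {nonneg R} | n%:R < s%:num]).
- by move=> n m nm s /=; apply: le_lt_trans; rewrite ler_nat.
- move=> x; have [t /bounded_on_exP[M M0 bM]] := bu x.
  exists (Num.truncn t%:num).+1; apply/bounded_on_exP; exists M => // s /= ts.
  by apply: bM => /=; apply: lt_trans ts; exact: truncnS_gt.
by exists (n%:R)%:nng => x; exact: bn.
Qed.
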